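(* Let $Y=[y_L,y_U]$ be a random interval with $\mathbf E(|y_L|+|y_U|)<\infty$ and let $A\subseteq\mathbb R$ be a fixed Borel set. At the mean extremes, $$U(\mathbf E y_U)=L(\mathbf E y_U)=\mathbf P(y_U\in A),\qquad U(\mathbf E y_L)=L(\mathbf E y_L)=\mathbf P(y_L\in A),$$ and for all $\kappa\in[\mathbf E y_L,\mathbf E y_U]$, $$\mathbf P(Y\subseteq A)\le L(\kappa)\le U(\kappa)\le\mathbf P(Y\cap A\ne\varnothing).$$
   Context: $(\Omega,\mathcal A,\mathbf P)$ is a complete non-atomic probability space. A random interval is $Y(\omega)=[y_L(\omega),y_U(\omega)]\subset\mathbb R$ with $y_L,y_U$ measurable real-valued and $\mathbf P(y_L\le y_U)=1$. $\mathbf{Sel}(Y)$ is the set of measurable $y:\Omega\to\mathbb R$ with $y(\omega)\in Y(\omega)$ a.s., and $\mathbf{Sel}(Y\mid\kappa):=\{y\in\mathbf{Sel}(Y):\mathbf E[y]=\kappa\}$. For $\kappa\in[\mathbf E y_L,\mathbf E y_U]$, $U(\kappa):=\sup_{y\in\mathbf{Sel}(Y\mid\kappa)}\mathbf P(y\in A)$ and $L(\kappa):=\inf_{y\in\mathbf{Sel}(Y\mid\kappa)}\mathbf P(y\in A)$. *)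

(* Defs.v *)
From HB Require Import structures.
From mathcomp Require Import all_boot all_order all_algebra.
From mathcomp Require Import all_classical all_reals all_analysis.

Set Implicit Arguments.
Unset Strict Implicit.
Unset Printing Implicit Defensive.

Import Order.TTheory GRing.Theory Num.Theory.
Import numFieldNormedType.Exports.

Local Open Scope classical_set_scope.
Local Open Scope ring_scope.

Definition atom (d : measure_display) (T : measurableType d) (R : realType)
    (P : probability T R) (B : set T) : Prop :=
  [/\ measurable B, (0 < P B)%E &
      forall C : set T, measurable C -> C `<=` B -> P C = 0%E \/ P C = P B].

Definition nonatomic (d : measure_display) (T : measurableType d)
    (R : realType) (P : probability T R) : Prop :=
  forall B : set T, ~ atom P B.

(* The value is the empty set on the null event where yU w < yL w. *)
Definition random_itv (T : Type) (R : realType) (yL yU : T -> R) (w : T) :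
    set R :=
  `[yL w, yU w].

Definition Sel (d : measure_display) (T : measurableType d) (R : realType)
    (P : probability T R) (Y : T -> set R) : set {RV P >-> R} :=
  [set y : {RV P >-> R} | {ae P, forall w, Y w (y w)}].

Arguments Sel {d T R} P Y.

Definition Sel_mean (d : measure_display) (T : measurableType d)
    (R : realType) (P : probability T R) (Y : T -> set R) (kappa : R) :
    set {RV P >-> R} :=
  [set y : {RV P >-> R} | Sel P Y y /\ ('E_P[y] = kappa%:E)%E].

Arguments Sel_mean {d T R} P Y kappa.

(* The extrema are taken in \bar R: over an empty set of selections the
   supremum would be -oo and the infimum +oo. *)
Definition upper_prob (d : measure_display) (T : measurableType d)
    (R : realType) (P : probability T R) (Y : T -> set R) (A : set R)
    (kappa : R) : \bar R :=
  ereal_sup [set P (y @^-1` A) | y in Sel_mean P Y kappa].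

Definition lower_prob (d : measure_display) (T : measurableType d)
    (R : realType) (P : probability T R) (Y : T -> set R) (A : set R)
    (kappa : R) : \bar R :=
  ereal_inf [set P (y @^-1` A) | y in Sel_mean P Y kappa].

(* Main.v *)
Require Import Defs.
From HB Require Import structures.
From mathcomp Require Import all_boot all_order all_algebra.
From mathcomp Require Import all_classical all_reals all_analysis.
From mathcomp Require Import measurable_realfun.
From mathcomp Require Import lra.

Set Implicit Arguments.
Unset Strict Implicit.
Unset Printing Implicit Defensive.

Import Order.TTheory GRing.Theory Num.Theory.
Import numFieldNormedType.Exports.

Local Open Scope classical_set_scope.
Local Open Scope ring_scope.

(** The endpoint identities say that a selection with an extreme mean has no
freedom left: if [y <= yU] almost surely and [E y = E yU] is finite, then
[yU - y] is a nonnegative variable of mean zero, hence null almost surely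
([ae_le_expectation_eq]).  All values [P (y \in A)] over such selections then
coincide with [P (yU \in A)], and so do their supremum and infimum
([extrema_prob_cst]).

For the bounds at a general mean [kappa], a selection [y] has [y w \in Y w]
almost surely, so [Y w `<=` A] forces [y w \in A], and [y w \in A] forces
[Y w] to meet [A]; probabilities are monotone along almost sure implications
([ae_le_prob]).  Two points need an argument.  Monotonicity requires the events
[Y `<=` A] and [Y `&` A !=set0] to be measurable although each quantifies over
the uncountably many points of [Y w].  Meeting [A] at an endpoint is a Borel
condition on that endpoint, and meeting it strictly inside is a countable
disjunction over rational subintervals ([itv_meetE], [measurable_itv_meet]);
inclusion in [A] is the failure to meet the complement of [A].  The inequality
[L kappa <= U kappa] requires a selection of mean [kappa], and a convex
combination of the two endpoints is one ([Sel_mean_nonempty]). *)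

(** * Measurability of the hitting and inclusion events *)

(** If [A] is met only at an interior point [c], two rationals separate [c] from
the endpoints.  The condition on the rational interval does not involve [a] and
[b], which therefore enter through order comparisons only. *)
Lemma itv_meetE (R : realType) (a b : R) (A : set R) : a <= b ->
  `[a, b] `&` A !=set0 <->
  [\/ A a, A b | exists p q : rat,
     [/\ a < ratr p, ratr q < b & `[ratr p, ratr q] `&` A !=set0]].
Proof.
move=> ab; split=> [[c [/=]]|].
  rewrite in_itv/= => /andP[ac cb] Ac.
  move: ac; rewrite le_eqVlt => /predU1P[->|ac]; first exact: Or31.
  move: cb; rewrite le_eqVlt => /predU1P[<-|cb]; first exact: Or32.
  have [p] := rat_in_itvoo ac; have [q] := rat_in_itvoo cb.
  rewrite !in_itv/= => /andP[cq qb] /andP[ap pc].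
  apply: Or33; exists p, q; split => //; exists c; split => //=.
  by rewrite in_itv/= !ltW.
move=> [Aa|Ab|[p [q [ap qb [c [/=]]]]]].
- by exists a; split => //=; rewrite in_itv/= lexx.
- by exists b; split => //=; rewrite in_itv/= lexx andbT.
rewrite in_itv/= => /andP[pc cq] Ac; exists c; split => //=.
by rewrite in_itv/= (ltW (lt_le_trans ap pc)) (ltW (le_lt_trans cq qb)).
Qed.

(** By [itv_meetE] the event is a countable union of Borel conditions on the
endpoints; it is cut down to the event where the interval is nonempty, since
elsewhere [yL w \in A] does not make [Y w] meet [A]. *)
Lemma measurable_itv_meet (d : measure_display) (T : measurableType d)
    (R : realType) (yL yU : {mfun T >-> R}) (A : set R) :
  measurable A ->
  measurable [set w | random_itv yL yU w `&` A !=set0].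
Proof.
move=> mA.
have mlt (X Z : T -> R) : measurable_fun setT X -> measurable_fun setT Z ->
    measurable [set w | X w < Z w].
  move=> mX mZ; rewrite -[X in measurable X]setTI.
  exact: (measurable_fun_ltr mX mZ measurableT (Y := [set true])).
pose hit := yL @^-1` A `|` yU @^-1` A `|`
  \bigcup_(p : rat) \bigcup_(q : rat)
    ([set w | yL w < ratr p] `&` [set w | ratr q < yU w]
     `&` [set _ | `[ratr p, (ratr q : R)] `&` A !=set0]).
rewrite (_ : mkset _ = ~` [set w | yU w < yL w] `&` hit).
  apply: measurableI; first by apply: measurableC; exact: mlt.
  apply: measurableU.
    by apply: measurableU; exact: measurable_funPTI.
  apply: bigcupT_measurable_rat => p; apply: bigcupT_measurable_rat => q.
  apply: measurableI; first by apply: measurableI; exact: mlt.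
  have [h|h] := pselect (`[ratr p, (ratr q : R)] `&` A !=set0).
    by rewrite (_ : mkset _ = setT) //; apply/seteqP; split.
  by rewrite (_ : mkset _ = set0) //; apply/seteqP; split.
apply/seteqP; split=> [w /= h|w /= [/negP]].
  have le_w : yL w <= yU w.
    by case: h => c []; rewrite /random_itv/= in_itv/= => /andP[Lc cU] _; exact: le_trans cU.
  split; first by apply/negP; rewrite -leNgt.
  move: h; rewrite /random_itv itv_meetE//.
  move=> [Aa|Ab|[p [q [ap qb h]]]]; first by left; left.
    by left; right.
  by right; exists p => //; exists q.
rewrite -leNgt => le_w h; apply/itv_meetE => //.
case: h => [[Aa|Ab]|[p _ [q _ [[ap qb] h]]]]; first exact: Or31.
  exact: Or32.
by apply: Or33; exists p, q.
Qed.

Lemma measurable_itv_sub (d : measure_display) (T : measurableType d)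
    (R : realType) (yL yU : {mfun T >-> R}) (A : set R) :
  measurable A ->
  measurable [set w | random_itv yL yU w `<=` A].
Proof.
move=> mA; rewrite (_ : mkset _ =
    ~` [set w | random_itv yL yU w `&` ~` A !=set0]).
  by apply: measurableC; apply: measurable_itv_meet; exact: measurableC.
apply/seteqP; split=> w /=.
  by move=> sYA [c [/sYA]].
by move=> h c Yc; apply: contrapT => nAc; apply: h; exists c.
Qed.

(** * Almost sure comparison *)

Section almost_sure_comparison.
Context (d : measure_display) (T : measurableType d) (R : realType).
Context (P : probability T R).

Lemma ae_le_prob (B C : set T) : measurable B -> measurable C ->
  {ae P, forall w, B w -> C w} -> (P B <= P C)%E.
Proof.
move=> mB mC [N [mN PN0 BCN]].
rewrite (@le_trans _ _ (P (C `|` N)))//.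
  apply: le_measure; rewrite ?inE//; first exact: measurableU.
  move=> w Bw; have [Cw|nCw] := pselect (C w); first by left.
  by right; apply: BCN => /= /(_ Bw).
apply: (le_trans (measureU2 P mC mN)); rewrite -[leRHS]adde0.
by apply: leeD => //; rewrite -[leRHS]PN0.
Qed.

Lemma ae_eq_prob (X Z : {RV P >-> R}) (A : set R) : measurable A ->
  {ae P, forall w, X w = Z w} -> P (X @^-1` A) = P (Z @^-1` A).
Proof.
move=> mA XZ; apply/eqP; rewrite eq_le; apply/andP; split.
  by apply: ae_le_prob; [exact: measurable_funPTI..|];
    apply: filterS XZ => w /= ->.
by apply: ae_le_prob; [exact: measurable_funPTI..|];
  apply: filterS XZ => w /= ->.
Qed.

Lemma Lfun1_dominated (X g : T -> R) :
  measurable_fun setT X -> measurable_fun setT g -> (forall w, 0 <= g w) ->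
  ('E_P[g] < +oo)%E -> {ae P, forall w, `|X w| <= g w} -> X \in Lfun P 1.
Proof.
move=> mX mg g0 Eg Xg; apply/Lfun1_integrable/integrableP; split.
  exact/measurable_EFinP.
apply: le_lt_trans Eg.
suff : ('E_P[(fun w => `|X w|)%R] <= 'E_P[g])%E by rewrite unlock.
by apply: expectation_le => //; exact: measurableT_comp.
Qed.

(** The integral of [`|Z - X|] is [E Z - E X = 0]; integrability matters, as
equal infinite means would carry no information. *)
Lemma ae_le_expectation_eq (X Z : {RV P >-> R}) :
  (X : T -> R) \in Lfun P 1 -> (Z : T -> R) \in Lfun P 1 ->
  {ae P, forall w, X w <= Z w} -> 'E_P[X]%E = 'E_P[Z]%E ->
  {ae P, forall w, X w = Z w}.
Proof.
move=> LX LZ XZ EXZ.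
have mD : measurable_fun setT (fun w => (Z w - X w)%:E).
  by apply/measurable_EFinP; exact: measurable_funB.
have : (\int[P]_w `|(Z w - X w)%:E| = 0)%E.
  rewrite (ae_eq_integral (fun w => (Z w - X w)%:E))//.
  - have := expectationB LZ LX.
    by rewrite EXZ subee ?expectation_fin_num// unlock.
  - exact: measurableT_comp.
  - by apply: filterS XZ => w /= XZw _; rewrite ger0_norm ?subr_ge0.
move/(ae_eq_integral_abs _ measurableT mD).
by apply: filterS => w /= /(_ I) [] /eqP; rewrite subr_eq0 => /eqP ->.
Qed.

End almost_sure_comparison.

(** * Selections of a random interval *)

Section selections.
Context (d : measure_display) (T : measurableType d) (R : realType).
Context (P : probability T R).
Context (yL yU : {RV P >-> R}).
Context (yL_le_yU : P [set w | yL w <= yU w] = 1%E).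
Context (y_integrable :
  ('E_P[(fun w => `|yL w| + `|yU w|)%R] < +oo)%E).

Lemma ae_yL_le_yU : {ae P, forall w, yL w <= yU w}.
Proof.
have mle : measurable [set w | yL w <= yU w].
  rewrite -[X in measurable X]setTI.
  by apply: (measurable_fun_ler (f := yL) (g := yU) _ _ measurableT
    (Y := [set true])).
apply/negligibleP; first exact: measurableC.
by have := probability_setC P mle; rewrite yL_le_yU subee.
Qed.

Lemma Sel_Lfun1 (y : {RV P >-> R}) :
  Sel P (random_itv yL yU) y -> (y : T -> R) \in Lfun P 1.
Proof.
move=> Yy; apply: (Lfun1_dominated _ _ _ y_integrable) => //.
  by apply: measurable_funD; exact: measurableT_comp.
apply: filterS Yy => w; rewrite /random_itv/= in_itv/= => /andP[Ly yU'].
rewrite ler_norml; apply/andP; split.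
  by rewrite lerNl; have := ler_norm (- yL w); have := normr_ge0 (yU w);
    rewrite normrN; lra.
by have := ler_norm (yU w); have := normr_ge0 (yL w); lra.
Qed.

Lemma Sel_yL : Sel P (random_itv yL yU) yL.
Proof.
by apply: filterS ae_yL_le_yU => w /=; rewrite /random_itv/= in_itv/= lexx.
Qed.

Lemma Sel_yU : Sel P (random_itv yL yU) yU.
Proof.
by apply: filterS ae_yL_le_yU => w /=; rewrite /random_itv/= in_itv/= lexx andbT.
Qed.

Lemma Sel_mean_yU_ae (y : {RV P >-> R}) :
  Sel_mean P (random_itv yL yU) (fine 'E_P[yU]%E) y ->
  {ae P, forall w, y w = yU w}.
Proof.
move=> [Yy Ey]; apply: ae_le_expectation_eq; first exact: Sel_Lfun1.
- exact/Sel_Lfun1/Sel_yU.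
- by apply: filterS Yy => w; rewrite /random_itv/= in_itv/= => /andP[].
- by rewrite Ey fineK ?expectation_fin_num//; exact/Sel_Lfun1/Sel_yU.
Qed.

Lemma Sel_mean_yL_ae (y : {RV P >-> R}) :
  Sel_mean P (random_itv yL yU) (fine 'E_P[yL]%E) y ->
  {ae P, forall w, y w = yL w}.
Proof.
move=> [Yy Ey].
suff : {ae P, forall w, yL w = y w} by apply: filterS => w ->.
apply: ae_le_expectation_eq; first exact/Sel_Lfun1/Sel_yL.
- exact: Sel_Lfun1.
- by apply: filterS Yy => w; rewrite /random_itv/= in_itv/= => /andP[].
- by rewrite Ey fineK ?expectation_fin_num//; exact/Sel_Lfun1/Sel_yL.
Qed.

(** Moving from [yL] to [yU] along convex combinations, the mean runs through
the whole interval between the extreme means. *)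
Lemma Sel_mean_nonempty (kappa : R) :
  ('E_P[yL] <= kappa%:E <= 'E_P[yU])%E ->
  Sel_mean P (random_itv yL yU) kappa !=set0.
Proof.
have LL : (yL : T -> R) \in Lfun P 1 by exact/Sel_Lfun1/Sel_yL.
have LU : (yU : T -> R) \in Lfun P 1 by exact/Sel_Lfun1/Sel_yU.
have := expectation_fin_num LL; have := expectation_fin_num LU.
case EU : ('E_P[yU])%E => [b| |]//; case EL : ('E_P[yL])%E => [a| |]// _ _.
rewrite !lee_fin => /andP[ak kb].
(* If [a = b] the quotient is 0 by convention, and [y = yL] has mean
   [a = kappa]: the degenerate case needs no separate witness. *)
pose t := (kappa - a) / (b - a).
have t01 : 0 <= t <= 1.
  rewrite /t; have [ab|ab] := eqVneq a b.
    by rewrite ab subrr invr0 mulr0 lexx ler01.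
  have ba0 : 0 < b - a by rewrite subr_gt0 lt_neqAle ab (le_trans ak).
  apply/andP; split; first by apply: divr_ge0; rewrite ?(ltW ba0)// subr_ge0.
  by rewrite ler_pdivrMr// mul1r lerB.
have tk : a + t * (b - a) = kappa.
  rewrite /t; have [ab|ab] := eqVneq a b.
    by move: ak kb; rewrite ab subrr mulr0 addr0; lra.
  by rewrite divfK ?subr_eq0 1?eq_sym// subrKC.
pose y : {RV P >-> R} := yL + t *: (yU - yL).
exists y; split.
  apply: filterS ae_yL_le_yU => w le_w; rewrite /random_itv/= in_itv/=.
  change (yL w <= yL w + t * (yU w - yL w) <= yU w).
  have [t0 t1] := andP t01; apply/andP; split.
    by rewrite lerDl mulr_ge0// subr_ge0.
  by rewrite -lerBrDl ler_piMl// subr_ge0.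
have -> : (y : T -> R) = yL \+ t \o* (yU \- yL).
  by apply/funext => w; rewrite /y/= mulrC.
have LD : yU \- yL \in Lfun P 1 by exact: rpredB.
rewrite expectationD//; last exact: Lfun_scale.
by rewrite expectationZl// expectationB// EU EL -EFinB -EFinM -EFinD tk.
Qed.

End selections.

Lemma extrema_prob_cst (d : measure_display) (T : measurableType d)
    (R : realType) (P : probability T R) (Y : T -> set R) (A : set R)
    (kappa : R) (y0 : {RV P >-> R}) : measurable A ->
  Sel_mean P Y kappa y0 ->
  (forall y, Sel_mean P Y kappa y -> {ae P, forall w, y w = y0 w}) ->
  upper_prob P Y A kappa = P (y0 @^-1` A) /\
  lower_prob P Y A kappa = P (y0 @^-1` A).
Proof.
move=> mA Yy0 Yae; rewrite /upper_prob /lower_prob.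
have -> : [set P (y @^-1` A) | y in Sel_mean P Y kappa] =
    [set P (y0 @^-1` A)].
  apply/seteqP; split=> [_ [y Yy <-]|_ ->]; last by exists y0.
  by apply: ae_eq_prob => //; exact: Yae.
by rewrite ereal_sup1 ereal_inf1.
Qed.

Theorem proposition2p16 (d : measure_display) (T : measurableType d)
  (R : realType) (P : probability T R)
  (P_complete : measure_is_complete P) (P_nonatomic : nonatomic P)
  (yL yU : {RV P >-> R})
  (yL_le_yU : P [set w | yL w <= yU w] = 1%E)
  (y_integrable : ('E_P[(fun w => `|yL w| + `|yU w|)%R] < +oo)%E)
  (A : set R) (mA : measurable A) :
  let Y := random_itv yL yU in
  let U := upper_prob P Y A in
  let L := lower_prob P Y A in
  [/\ U (fine 'E_P[yU]%E) = P (yU @^-1` A) /\ L (fine 'E_P[yU]%E) = P (yU @^-1` A),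
      U (fine 'E_P[yL]%E) = P (yL @^-1` A) /\ L (fine 'E_P[yL]%E) = P (yL @^-1` A)
    & forall kappa : R, ('E_P[yL] <= kappa%:E <= 'E_P[yU])%E ->
      [/\ (P [set w | (Y w `<=` A)%classic] <= L kappa)%E,
          (L kappa <= U kappa)%E
        & (U kappa <= P [set w | (Y w `&` A !=set0)%classic])%E]].
Proof.
move=> Y U L.
have YL : Sel P Y yL by exact: Sel_yL.
have YU : Sel P Y yU by exact: Sel_yU.
split.
- apply: extrema_prob_cst => //; last exact: Sel_mean_yU_ae.
  by split=> //; rewrite fineK// expectation_fin_num//; exact: Sel_Lfun1 YU.
- apply: extrema_prob_cst => //; last exact: Sel_mean_yL_ae.
  by split=> //; rewrite fineK// expectation_fin_num//; exact: Sel_Lfun1 YL.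
move=> kappa kappaP; split.
- apply: le_ereal_inf_tmp => _ [y [Yy _] <-].
  apply: ae_le_prob; [exact: measurable_itv_sub|exact: measurable_funPTI|].
  by apply: filterS Yy => w Yyw /=; exact.
- have [y Yy] := Sel_mean_nonempty yL_le_yU y_integrable kappaP.
  apply: (@le_trans _ _ (P (y @^-1` A))).
    by apply: ereal_inf_lbound; exists y.
  by apply: ereal_sup_ubound; exists y.
- apply: ge_ereal_sup => _ [y [Yy _] <-].
  apply: ae_le_prob; [exact: measurable_funPTI|exact: measurable_itv_meet|].
  by apply: filterS Yy => w Yyw /= Ayw; exists (y w).
Qed.
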